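(* Let $n\ge 1$ and $W=\{w_1,\ldots,w_n\}$, where $w_1,\ldots,w_n$ are regarded as indeterminates, and let $\Pi(W)$ be the $2^{n-1}\times 2^{n-1}$ partition matrix of $W$. Then the determinant of $\Pi(W)$ is the partition polynomial of $W$; that is, in $\mathbb{Z}[w_1,\ldots,w_n]$ (and hence for all integer values of $w_1,\ldots,w_n$), $$\det\big(\Pi(W)\big)=\prod_{s\in\{-1,1\}^{n-1}}\Bigg(\bigg(\sum_{i=1}^{n-1}s_iw_i\bigg)+w_n\Bigg).$$
   Context: Notation: $[n]=\{1,\ldots,n\}$. Order on subsets of $[n]$ (graded reverse lexicographic order $\succeq_D$): for $S\subseteq[n]$ let $v_S\in\{0,1\}^n$ be its indicator vector. For distinct $S,S'\subseteq[n]$, $S\succeq_D S'$ if either $|S|>|S'|$, or $|S|=|S'|$ and the right-most nonzero entry of $v_S-v_{S'}$ is negative. Partition matrix: given $W=\{w_1,\ldots,w_n\}$, the partition matrix $\Pi(W)$ is the coefficient matrix of the following square linear system in the $2^{n-1}$ unknowns $b_T$, one for each odd-cardinality subset $T\subseteq[n]$ (writing $b_i$ for $b_{\{i\}}$): $$\sum_{j\notin S}b_{S\cup\{j\}}w_j+\sum_{j\in S}b_{S\setminus\{j\}}w_j=0\quad\text{for each nonempty }S\subseteq[n]\text{ with }|S|\text{ even},$$ $$\sum_{i=1}^n b_iw_i=1\quad(\text{the equation for }S=\emptyset).$$ Columns are indexed by the odd-cardinality subsets $T$ of $[n]$ and rows by the even-cardinality subsets $S$ of $[n]$ (including $\emptyset$),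 both listed in the order $\succeq_D$ (if $S\succeq_D S'$ then $S$ is listed before $S'$). Equivalently, the entry in row $S$ and column $T$ is $w_j$ if the symmetric difference $S\,\Delta\,T$ equals $\{j\}$, and is $0$ if $|S\,\Delta\,T|\neq 1$. Partition polynomial: the partition polynomial of $W$ is $\prod_{s\in\{-1,1\}^{n-1}}\big(\big(\sum_{i=1}^{n-1}s_iw_i\big)+w_n\big)$, where $s_i$ denotes the $i$-th entry of $s$. *)

(* Defs.v *)
From mathcomp Require Import all_boot all_order all_algebra.
From mathcomp.multinomials Require Export mpoly.

Set Implicit Arguments.
Unset Strict Implicit.
Unset Printing Implicit Defensive.

Import Order.TTheory GRing.Theory Num.Theory.
Local Open Scope ring_scope.

(* The element k of {1, ..., n} is the ordinal of value k - 1 in 'I_n. *)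

Definition indicator n (S : {set 'I_n}) : 'rV[int]_n :=
  \row_i (i \in S)%:R.

Definition rightmost_neg n (v : 'rV[int]_n) : bool :=
  [exists i : 'I_n,
    (v ord0 i < 0) && [forall j : 'I_n, (i < j)%N ==> (v ord0 j == 0)]].

(* Graded reverse lexicographic order: "S is listed before S'". The reflexive
   case S = S' is included because [sort] expects a total relation. *)
Definition succD n (S S' : {set 'I_n}) : bool :=
  [|| S == S',
      (#|S'| < #|S|)%N
    | (#|S| == #|S'|) && rightmost_neg (indicator S - indicator S')].

Definition even_sets n : seq {set 'I_n} :=
  sort (@succD n) (enum [set S : {set 'I_n} | ~~ odd #|S|]).

Definition odd_sets n : seq {set 'I_n} :=
  sort (@succD n) (enum [set T : {set 'I_n} | odd #|T|]).

(* Left-hand side of the equation attached to S, at the values b of the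
   unknowns; for S = set0 it is the sum of the b_{j} * w_j. *)
Definition system_lhs (R : comNzRingType) n (w : 'I_n -> R)
    (b : {set 'I_n} -> R) (S : {set 'I_n}) : R :=
  \sum_(j | j \notin S) b (j |: S) * w j + \sum_(j in S) b (S :\ j) * w j.

(* [system_lhs] is linear in b (see [system_lhsE]), so the coefficient of the
   unknown b_T is its value when b_T = 1 and all other unknowns vanish. *)
Definition system_coef (R : comNzRingType) n (w : 'I_n -> R)
    (S T : {set 'I_n}) : R :=
  system_lhs w (fun U => (U == T)%:R) S.

(* There are n.+1 weights, the last one being w ord_max. The default value
   set0 of [nth] is never used, by [size_even_sets] and [size_odd_sets]. *)
Definition partition_matrix (R : comNzRingType) n (w : 'I_n.+1 -> R) :
    'M[R]_(2 ^ n) :=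
  \matrix_(i, j)
    system_coef w (nth set0 (even_sets n.+1) i) (nth set0 (odd_sets n.+1) j).

(* A sign vector is encoded by s : {ffun 'I_n -> bool}, with signs
   (-1) ^+ s i. *)
Definition partition_poly (R : comNzRingType) n (w : 'I_n.+1 -> R) : R :=
  \prod_(s : {ffun 'I_n -> bool})
    ((\sum_(i < n) (-1) ^+ s i * w (widen_ord (leqnSn n) i)) + w ord_max).

Lemma system_lhsE (R : comNzRingType) n (w : 'I_n -> R)
    (b : {set 'I_n} -> R) (S : {set 'I_n}) :
  system_lhs w b S = \sum_(T : {set 'I_n}) system_coef w S T * b T.
Proof.
have pick U x : b U * x = \sum_(T : {set 'I_n}) (U == T)%:R * x * b T.
  rewrite (bigD1 U) //= big1 ?addr0 => [|T neTU]; first by rewrite eqxx mul1r mulrC.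
  by rewrite eq_sym (negbTE neTU) !mul0r.
under [RHS]eq_bigr => T _ do rewrite mulrDl !mulr_suml.
rewrite big_split /=; congr (_ + _); rewrite exchange_big /=.
  by apply: eq_bigr => j _; apply: pick.
by apply: eq_bigr => j _; apply: pick.
Qed.

Lemma card_even_odd_sets n :
  #|[set S : {set 'I_n.+1} | ~~ odd #|S| ]| = (2 ^ n)%N /\
  #|[set S : {set 'I_n.+1} | odd #|S| ]| = (2 ^ n)%N.
Proof.
pose tog (S : {set 'I_n.+1}) := if ord0 \in S then S :\ ord0 else ord0 |: S.
have togK : involutive tog.
  move=> S; rewrite /tog; case: (boolP (ord0 \in S)) => S0.
    by rewrite !inE eqxx /= setD1K.
  by rewrite !inE eqxx /= setU1K.
have odd_tog S : odd #|tog S| = ~~ odd #|S|.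
  rewrite /tog; case: ifP => S0; last by rewrite cardsU1 S0 /= .
  by rewrite [in RHS](cardsD1 ord0) S0 /= negbK.
set E := [set S | ~~ _]; set O := [set S | _].
have EO : #|E| = #|O|.
  rewrite -(card_imset (mem E) (inv_inj togK)); apply: eq_card => S.
  rewrite !inE; apply/imsetP/idP => [[U] | oS].
    by rewrite !inE => eU ->; rewrite odd_tog.
  by exists (tog S); rewrite ?togK // !inE odd_tog negbK.
have : (#|O| + #|E| = 2 ^ n.+1)%N.
  have -> : E = ~: O by apply/setP => S; rewrite !inE.
  by rewrite cardsC -cardsT -powersetT card_powerset cardsT card_ord.
by rewrite EO addnn expnS mul2n => /double_inj ->.
Qed.

Lemma size_even_sets n : size (even_sets n.+1) = (2 ^ n)%N.
Proof. by rewrite size_sort -cardE; case: (card_even_odd_sets n). Qed.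

Lemma size_odd_sets n : size (odd_sets n.+1) = (2 ^ n)%N.
Proof. by rewrite size_sort -cardE; case: (card_even_odd_sets n). Qed.

(* Main.v *)
(** Toggling the membership of the last element n is an order-preserving
    bijection from the even to the odd sets, so it matches the i-th row with
    the i-th column. After this identification the partition matrix is the
    matrix of convolution by [w_n + sum_j w_j {j}] on the group (Z/2)^(n-1) of
    subsets of [n-1], and the character table H of this group diagonalises it:
    H * Pi = D * H, where D carries the factors of the partition polynomial.
    Since H^T * H = 2^(n-1), the determinant of H can be cancelled. *)
Require Import Defs.
From mathcomp Require Import all_boot all_order all_algebra.
From mathcomp.multinomials Require Import mpoly.
From mathcomp Require Import zify.

Set Implicit Arguments.
Unset Strict Implicit.
Unset Printing Implicit Defensive.

Import Order.TTheory GRing.Theory Num.Theory.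
Local Open Scope ring_scope.

(** * The listing order is a total order *)

Lemma rightmost_negP n (S S' : {set 'I_n}) :
  reflect (exists i : 'I_n, [/\ i \notin S, i \in S' &
             forall j : 'I_n, (i < j)%N -> (j \in S) = (j \in S')])
          (rightmost_neg (indicator S - indicator S')).
Proof.
apply: (iffP existsP) => [[i /andP[lti /forallP eqi]] | [i [iS iS' eqi]]].
  exists i; move: lti; rewrite !mxE; case: (i \in S); case: (i \in S') => //= _.
  split=> // j ltij; move: (eqi j); rewrite ltij !mxE.
  by case: (j \in S); case: (j \in S').
exists i; rewrite !mxE (negbTE iS) iS' /=; apply/forallP=> j; apply/implyP=> ltij.
by rewrite !mxE (eqi _ ltij) subrr.
Qed.

Lemma succD_trans n : transitive (@succD n).
Proof.
move=> S2 S1 S3; rewrite /succD.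
case/or3P=> [/eqP-> //|lt12|/andP[/eqP e12 /rightmost_negP[i [i1 i2 eqi]]]].
  case/or3P=> [/eqP<-|lt23|/andP[/eqP e23 _]]; first by rewrite lt12 orbT.
    by rewrite (ltn_trans lt23 lt12) orbT.
  by rewrite -e23 lt12 orbT.
case/or3P=> [/eqP<-|lt23|/andP[/eqP e23 /rightmost_negP[j [j2 j3 eqj]]]].
- rewrite e12 eqxx /=; apply/or3P; apply: Or33.
  by apply/rightmost_negP; exists i.
- by rewrite e12 lt23 orbT.
apply/or3P; apply: Or33; rewrite e12 e23 eqxx /=; apply/rightmost_negP.
(* The larger of the two deciding indices decides between [S1] and [S3]; they cannot coincide, since
   [S2] contains [i] but not [j]. *)
have [ltij|ltji|eqij] := ltngtP i j.
- exists j; split=> [||k ltjk] //; first by rewrite eqi.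
  by rewrite eqi ?eqj //; apply: ltn_trans ltjk.
- exists i; split=> [||k ltik] //; first by rewrite -eqj.
  by rewrite eqi ?eqj //; apply: ltn_trans ltik.
by move/val_inj: eqij j2 => <-; rewrite i2.
Qed.

Lemma succD_anti n : antisymmetric (@succD n).
Proof.
move=> S1 S2; rewrite /succD [S2 == S1]eq_sym [#|S2| == _]eq_sym.
case: eqVneq => //= _; case: ltngtP => //= _.
case/andP=> /rightmost_negP[i [i1 i2 eqi]] /rightmost_negP[j [j2 j1 eqj]].
have [ltij|ltji|eqij] := ltngtP i j.
- by rewrite eqi ?(negbTE j2) in j1.
- by rewrite eqj ?(negbTE i1) in i2.
by move/val_inj: eqij i1 => ->; rewrite j1.
Qed.

Lemma succD_total n : total (@succD n).
Proof.
move=> S1 S2; rewrite /succD [S2 == S1]eq_sym [#|S2| == _]eq_sym.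
have [//|neS] := eqVneq S1 S2; case: ltngtP => //= _.
have [i0 Di0] : exists i, (i \in S1) != (i \in S2).
  apply/existsP; apply: contraNT neS => /existsPn eqS; apply/eqP/setP => i.
  by apply/eqP; have := eqS i; rewrite negbK.
(* The largest index at which the two sets differ decides their order. *)
case: (@arg_maxnP _ i0 (fun i => (i \in S1) != (i \in S2)) val Di0) => i Di maxi.
have eqi (j : 'I_n) : (i < j)%N -> (j \in S1) = (j \in S2).
  by move=> ltij; apply/eqP; apply: contraLR ltij => /maxi; rewrite -leqNgt.
case i1: (i \in S1) Di; case i2: (i \in S2) => // _; apply/orP; [right|left].
  by apply/rightmost_negP; exists i; rewrite i1 i2; split=> // j /eqi.
by apply/rightmost_negP; exists i; rewrite i1 i2; split=> // j /eqi.
Qed.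

(** * Toggling an element, and the matching of columns with rows *)

Section Toggle.

Variable T : finType.
Implicit Types (x y : T) (A B : {set T}).

Definition toggle x A := if x \in A then A :\ x else x |: A.

Lemma in_toggle x A y : (y \in toggle x A) = (y == x) (+) (y \in A).
Proof.
rewrite /toggle; case: ifP => xA; rewrite !inE; case: eqP => [->|] //=;
  by rewrite xA.
Qed.

Lemma toggleK x : involutive (toggle x).
Proof. by move=> A; apply/setP => y; rewrite !in_toggle addbA addbb. Qed.

Lemma card_toggle x A : #|toggle x A| = if x \in A then #|A|.-1 else #|A|.+1.
Proof.
rewrite /toggle; case: ifP => xA; last by rewrite cardsU1 xA.
by rewrite [in RHS](cardsD1 x) xA.
Qed.

Lemma odd_toggle x A : odd #|toggle x A| = ~~ odd #|A|.
Proof.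
rewrite card_toggle; case: ifP => // xA.
by rewrite (cardsD1 x) xA /= negbK.
Qed.

Lemma eq_toggle x A B : (toggle x A == B) = (A == toggle x B).
Proof. by rewrite -(inj_eq (inv_inj (toggleK x))) toggleK. Qed.

(** Equal parity makes the gap at least 2, and each toggle moves a cardinality by 1. The gap can
    only close when [A] loses [x] and [B] gains it. *)
Lemma card_toggle_lt x A B : odd #|A| = odd #|B| -> (#|B| < #|A|)%N ->
  (#|toggle x B| < #|toggle x A|)%N
    || [&& #|toggle x A| == #|toggle x B|, x \in A & x \notin B].
Proof. by move=> odAB ltBA; rewrite !card_toggle; do 2!case: ifP => _; lia. Qed.

End Toggle.

(** When toggling closes a gap in cardinality, the last element ends up in the toggled [S'] only,
    and so decides in favour of [S]. When the cardinalities agree and the last element decides, [S]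
    gains it and [S'] loses it, so [S] becomes the larger set. Otherwise both sets change alike and
    the deciding index stays the same. *)
Lemma succD_toggle_max n (S S' : {set 'I_n.+1}) :
  odd #|S| = odd #|S'| -> succD S S' ->
  succD (toggle ord_max S) (toggle ord_max S').
Proof.
move=> odS; case/or3P=> [/eqP->|ltS|/andP[/eqP eqS /rightmost_negP[i [i1 i2 eqi]]]].
- by rewrite /succD eqxx.
- have /orP[ltT|/and3P[eqT mS mS']] := card_toggle_lt ord_max odS ltS.
    by apply/or3P; apply: Or32.
  apply/or3P; apply: Or33; rewrite eqT /=; apply/rightmost_negP; exists ord_max.
  rewrite !in_toggle eqxx mS (negbTE mS').
  by split=> // j; rewrite ltnNge -ltnS ltn_ord.
have [ei|nei] := eqVneq i ord_max.
  by apply/or3P; apply: Or32; rewrite !card_toggle -ei (negbTE i1) i2; lia.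
apply/or3P; apply: Or33.
have lti : (i < (ord_max : 'I_n.+1))%N.
  by rewrite ltn_neqAle -(inj_eq val_inj) in nei *; rewrite nei -ltnS ltn_ord.
apply/andP; split; first by rewrite !card_toggle eqS (eqi _ lti).
apply/rightmost_negP; exists i; rewrite !in_toggle (negbTE nei) (negbTE i1) i2.
by split=> // j ltij; rewrite !in_toggle eqi.
Qed.

Lemma mem_even_sets n S : (S \in even_sets n) = ~~ odd #|S|.
Proof. by rewrite mem_sort mem_enum inE. Qed.

Lemma mem_odd_sets n S : (S \in odd_sets n) = odd #|S|.
Proof. by rewrite mem_sort mem_enum inE. Qed.

Lemma odd_sets_toggle n :
  odd_sets n.+1 = map (toggle ord_max) (even_sets n.+1).
Proof.
(* Two lists sorted for the same antisymmetric order are equal as soon as they are permutations of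
   each other. *)
apply: (sorted_eq (@succD_trans _) (@succD_anti _)).
- exact/sort_sorted/succD_total.
- have homoT : {in [pred S : {set 'I_n.+1} | ~~ odd #|S|] &,
      {homo toggle ord_max : S S' / succD S S'}}.
    move=> S S' /negbTE evS /negbTE evS'.
    by apply: succD_toggle_max; rewrite evS evS'.
  apply: (homo_sorted_in homoT); last exact/sort_sorted/succD_total.
  by apply/allP => S; rewrite mem_even_sets.
apply: uniq_perm; first by rewrite sort_uniq enum_uniq.
  by rewrite (map_inj_uniq (inv_inj (toggleK _))) sort_uniq enum_uniq.
move=> S; rewrite -[S in RHS](toggleK ord_max).
by rewrite (mem_map (inv_inj (toggleK _))) mem_odd_sets mem_even_sets odd_toggle negbK.
Qed.

Lemma nth_odd_sets n (i : 'I_(2 ^ n)) :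
  nth set0 (odd_sets n.+1) i = toggle ord_max (nth set0 (even_sets n.+1) i).
Proof. by rewrite odd_sets_toggle (nth_map set0) ?size_even_sets. Qed.

Lemma sum_nth_even_sets (V : nmodType) n (F : {set 'I_n.+1} -> V) :
  \sum_(i < 2 ^ n) F (nth set0 (even_sets n.+1) i)
    = \sum_(S : {set 'I_n.+1} | ~~ odd #|S|) F S.
Proof.
rewrite -(big_mkord xpredT (fun i => F (nth set0 (even_sets n.+1) i))).
rewrite -size_even_sets -(big_nth set0 xpredT F).
rewrite (perm_big _ (introT permPl (perm_sort _ _))) big_enum /=.
by apply: eq_bigl => S; rewrite inE.
Qed.

Lemma system_coefE (R : comNzRingType) n (w : 'I_n -> R) S T :
  system_coef w S T = \sum_j (toggle j S == T)%:R * w j.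
Proof.
rewrite /system_coef /system_lhs [RHS](bigID (mem S)) addrC /=.
by congr (_ + _); apply: eq_bigr => j jS; rewrite /toggle ?jS // (negbTE jS).
Qed.

(** * Characters of the group of subsets *)

Section Characters.

Variables (R : comNzRingType) (n : nat).
Implicit Types (s : {ffun 'I_n -> bool}) (S T : {set 'I_n.+1}).

(** The last element gets the sign 1, like the last weight in [partition_poly]. The resulting
    characters are therefore invariant under [toggle ord_max]. *)
Definition sign_ext s (j : 'I_n.+1) : R :=
  if unlift ord_max j is Some i then (-1) ^+ s i else 1.

Definition char s S : R := \prod_(j in S) sign_ext s j.

Lemma sign_ext_max s : sign_ext s ord_max = 1.
Proof. by rewrite /sign_ext unlift_none. Qed.

Lemma sign_ext_widen s i : sign_ext s (widen_ord (leqnSn n) i) = (-1) ^+ s i.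
Proof.
rewrite /sign_ext; have -> : widen_ord (leqnSn n) i = lift ord_max i.
  by apply: val_inj; rewrite /= /bump leqNgt ltn_ord.
by rewrite liftK.
Qed.

Lemma sign_extK s j : sign_ext s j * sign_ext s j = 1.
Proof.
by rewrite /sign_ext; case: unlift => [i|]; rewrite ?mul1r // -expr2 sqrr_sign.
Qed.

Lemma char_toggle s j S : char s (toggle j S) = sign_ext s j * char s S.
Proof.
rewrite /char /toggle; case: ifP => jS; last by rewrite big_setU1 //= jS.
by rewrite [in RHS](big_setD1 j) //= mulrA sign_extK mul1r.
Qed.

Lemma charE s S :
  char s S = \prod_(i < n) (-1) ^+ (s i && (widen_ord (leqnSn n) i \in S)).
Proof.
rewrite /char big_mkcond big_ord_recr /= sign_ext_max if_same mulr1.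
by apply: eq_bigr => i _; rewrite sign_ext_widen andbC; case: ifP.
Qed.

(** The sum factors over the coordinates, with a factor 2 where the sets agree and 0 where they
    differ. The characters do not see the last element, but equal parity forces sets that agree
    elsewhere to agree there too. *)
Lemma char_orthogonal S T : odd #|S| = odd #|T| ->
  \sum_s char s S * char s T = ((2 ^ n)%:R *+ (S == T) : R).
Proof.
move=> oST; pose d i := widen_ord (leqnSn n) i \in S.
pose d' i := widen_ord (leqnSn n) i \in T.
pose F i b : R := (-1) ^+ (b && d i) * (-1) ^+ (b && d' i).
under eq_bigr => s _ do rewrite !charE -big_split /=.
rewrite -(bigA_distr_bigA F) /=.
have sumF i : \sum_b F i b = (d i == d' i)%:R *+ 2.
  rewrite big_bool /F /= mulr1; case: (d i); case: (d' i) => /=.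
  - by rewrite mulrNN mulr1.
  - by rewrite mulr1 addNr mul0rn.
  - by rewrite mul1r addNr mul0rn.
  by rewrite mulr1.
under eq_bigr => i _ do rewrite sumF.
have [eST|neST] := eqVneq S T.
  under eq_bigr => i _ do rewrite /d /d' eST eqxx.
  by rewrite prodr_const card_ord natrX.
have /existsP[i dd'] : [exists i, d i != d' i].
  apply: contraNT neST => /existsPn eqd.
  have eqlt j : j != ord_max -> (j \in S) = (j \in T).
    case: (unliftP ord_max j) => [i -> _|->]; last by rewrite eqxx.
    have -> : lift ord_max i = widen_ord (leqnSn n) i.
      by apply: val_inj; rewrite /= /bump leqNgt ltn_ord.
    by have := eqd i; rewrite negbK => /eqP.
  have eqD : S :\ ord_max = T :\ ord_max.
    by apply/setP => j; rewrite !inE; case: eqVneq => //= /eqlt.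
  move: oST; rewrite (cardsD1 ord_max) [#|T|](cardsD1 ord_max) eqD !oddD.
  move/addIb => eqm; apply/eqP/setP => j; have [->|/eqlt //] := eqVneq j ord_max.
  by move: eqm; do 2!case: (ord_max \in _).
by rewrite (bigD1 i) //= (negbTE dd') mul0rn mul0r.
Qed.

(** For each [j], only the row [toggle j T] carries [w j] in column [T], and its character value is
    that of [T] times the sign of [j]. *)
Lemma char_system_coef (w : 'I_n.+1 -> R) s T : odd #|T| ->
  \sum_(S : {set 'I_n.+1} | ~~ odd #|S|) char s S * system_coef w S T
    = (\sum_j sign_ext s j * w j) * char s T.
Proof.
move=> oT; under eq_bigr => S _ do rewrite system_coefE mulr_sumr.
rewrite exchange_big mulr_suml /=; apply: eq_bigr => j _.
rewrite (bigD1 (toggle j T)) /=; last by rewrite odd_toggle oT.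
rewrite toggleK eqxx mul1r char_toggle big1 ?addr0 1?mulrAC // => S /andP[_ neS].
by rewrite eq_toggle (negbTE neS) mul0r mulr0.
Qed.

End Characters.

(** * The character table and the determinant *)

Lemma card_signs n : #|{ffun 'I_n -> bool}| = (2 ^ n)%N.
Proof. by rewrite card_ffun card_bool card_ord. Qed.

Definition nth_sign n (k : 'I_(2 ^ n)) : {ffun 'I_n -> bool} :=
  enum_val (cast_ord (esym (card_signs n)) k).

Lemma nth_sign_bij n : bijective (@nth_sign n).
Proof.
apply: (bij_comp (@enum_val_bij _)).
by exists (cast_ord (card_signs n)) => k; rewrite ?cast_ordK ?cast_ordKV.
Qed.

Definition char_matrix (R : comNzRingType) n : 'M[R]_(2 ^ n) :=
  \matrix_(k, i) char R (nth_sign k) (nth set0 (even_sets n.+1) i).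

Lemma odd_nth_even_sets n (i : 'I_(2 ^ n)) :
  odd #|nth set0 (even_sets n.+1) i| = false.
Proof. by apply/negbTE; rewrite -mem_even_sets mem_nth // size_even_sets. Qed.

Lemma char_matrix_gram (R : comNzRingType) n :
  (char_matrix R n)^T *m char_matrix R n = (2 ^ n)%:R%:M.
Proof.
apply/matrixP => i j; rewrite !mxE.
under eq_bigr => k _ do rewrite !mxE.
rewrite -(reindex _ (onW_bij _ (@nth_sign_bij n)) (P := xpredT)
  (F := fun s => char R s _ * char R s _)) /=.
rewrite char_orthogonal ?odd_nth_even_sets // nth_uniq ?size_even_sets //.
by rewrite sort_uniq enum_uniq.
Qed.

Lemma char_matrix_partition (R : comNzRingType) n (w : 'I_n.+1 -> R) :
  char_matrix R n *m partition_matrix w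
    = diag_mx (\row_k \sum_j sign_ext R (nth_sign k) j * w j)
        *m char_matrix R n.
Proof.
apply/matrixP => k j; rewrite mul_diag_mx !mxE.
under eq_bigr => i _ do rewrite !mxE.
rewrite (sum_nth_even_sets (fun S => char R (nth_sign k) S * system_coef w S _)).
rewrite nth_odd_sets char_system_coef ?odd_toggle ?odd_nth_even_sets //.
(* A column set and its matching row set have the same character values, so the same table stands on
   both sides. *)
by rewrite char_toggle sign_ext_max mul1r.
Qed.

(** The Gram identity gives the square of the determinant of the character table as
    [(2 ^ n) ^ (2 ^ n)]. This is nonzero in a domain where 2 is nonzero, which allows the
    cancellation. *)
Lemma det_partition_matrix (R : idomainType) n (w : 'I_n.+1 -> R) :
  (2 : R) != 0 -> \det (partition_matrix w) = partition_poly w.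
Proof.
move=> nz2; have nzH : \det (char_matrix R n) != 0.
  have := congr1 determinant (char_matrix_gram R n).
  rewrite det_mulmx det_tr det_scalar => detH.
  apply: contraTneq (expf_neq0 (2 ^ n) (expf_neq0 n nz2)) => H0.
  by rewrite -natrX -detH H0 mul0r eqxx.
apply: (mulfI nzH); rewrite -det_mulmx char_matrix_partition det_mulmx mulrC.
congr (_ * _); rewrite det_diag /partition_poly.
rewrite [RHS](reindex _ (onW_bij _ (@nth_sign_bij n))) /=.
apply: eq_bigr => k _; rewrite mxE big_ord_recr /= sign_ext_max mul1r.
by congr (_ + _); apply: eq_bigr => i _; rewrite sign_ext_widen.
Qed.

Theorem theorem6 (n : nat) :
  (\det (partition_matrix (fun i : 'I_n.+1 => ('X_i : {mpoly int[n.+1]})))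
   = partition_poly (fun i : 'I_n.+1 => ('X_i : {mpoly int[n.+1]})))%R
  /\ (forall w : 'I_n.+1 -> int,
        (\det (partition_matrix w) = partition_poly w)%R).
Proof.
split=> [|w]; apply: det_partition_matrix => //.
(* In the polynomial ring, 2 is a constant polynomial, so it is nonzero because it is nonzero in
   [int]. *)
by rewrite -mpolyC_nat mpolyC_eq0.
Qed.
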